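(* Let $\gamma\subseteq\mathbb P^2$ be an irreducible conic and let $X_1=\mathbb S(\ell_1,\ell_2,\ell_3)$, $X_2=\mathbb S(m_1,m_2,m_3)$, $X_3=\mathbb S(n_1,n_2,n_3)$ be contact star configurations on $\gamma$, where the nine tangent lines $\ell_i,m_j,n_k$ are distinct. For $1\le i<j\le3$ let $\gamma_{ij}$ be the conic containing $X_i\cup X_j$. Then $\gamma_{12},\gamma_{13},\gamma_{23}$ meet in a point, i.e. the three conics have a common point.
   Context: Work over $\mathbb C$. For three lines $\ell_1,\ell_2,\ell_3$ in $\mathbb P^2$ that are not concurrent, $\mathbb S(\ell_1,\ell_2,\ell_3)$ is the set of the three points $\ell_1\cap\ell_2,\ \ell_1\cap\ell_3,\ \ell_2\cap\ell_3$. It is a contact star configuration on an irreducible conic $\gamma$ if $\ell_1,\ell_2,\ell_3$ are the tangent lines to $\gamma$ at three distinct points of $\gamma$. For two contact star configurations on the same irreducible conic, each defined by three lines, with the six lines distinct, there is exactly one conic containing the six points of their union; this is the conic $\gamma_{ij}$ in the statement. *)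

(* Defs.v *)
From HB Require Import structures.
From mathcomp Require Import all_boot all_order all_algebra.
From mathcomp Require Import boolp classical_sets reals.
From mathcomp Require Import complex.
From mathcomp Require Import mpoly.

Set Implicit Arguments.
Unset Strict Implicit.
Unset Printing Implicit Defensive.

Import GRing.Theory.
Local Open Scope ring_scope.
Local Open Scope classical_set_scope.

(* The points and lines of the projective plane P(K^3) are the linear subspaces
   of K^3 of dimension 1 and 2, so equality of points (of lines) is Leibniz
   equality and incidence is inclusion of subspaces. *)
Record point (K : fieldType) := Point {
  point_space : {vspace 'rV[K]_3};
  _ : \dim point_space == 1%N }.
HB.instance Definition _ (K : fieldType) := [isSub for @point_space K].
HB.instance Definition _ (K : fieldType) := [Choice of point K by <:].

Record line (K : fieldType) := Line {
  line_space : {vspace 'rV[K]_3};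
  _ : \dim line_space == 2%N }.
HB.instance Definition _ (K : fieldType) := [isSub for @line_space K].
HB.instance Definition _ (K : fieldType) := [Choice of line K by <:].

Definition on_line (K : fieldType) (P : point K) (l : line K) : Prop :=
  (point_space P <= line_space l)%VS.

Definition concurrent (K : fieldType) (l1 l2 l3 : line K) : Prop :=
  exists P : point K, [/\ on_line P l1, on_line P l2 & on_line P l3].

(* For pairwise distinct lines each of the three intersections has dimension 1,
   i.e. is a point. *)
Definition star (K : fieldType) (l1 l2 l3 : line K) : set (point K) :=
  [set P | [\/ point_space P = (line_space l1 :&: line_space l2)%VS,
               point_space P = (line_space l1 :&: line_space l3)%VS |
               point_space P = (line_space l2 :&: line_space l3)%VS]].

(* A conic is represented by a nonzero quadratic form, two proportional forms
   representing the same conic; it may be reducible or non-reduced. *)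
Definition conic (K : fieldType) (F : {mpoly K[3]}) : Prop :=
  F != 0 /\ F \is 2.-homog.

Definition irreducible_mpoly (n : nat) (K : fieldType) (F : {mpoly K[n]}) :
    Prop :=
  [/\ F != 0, F \isn't a GRing.unit &
      forall G H : {mpoly K[n]}, F = G * H ->
        G \is a GRing.unit \/ H \is a GRing.unit].

Definition irreducible_conic (K : fieldType) (F : {mpoly K[3]}) : Prop :=
  conic F /\ irreducible_mpoly F.

Definition zeros (K : fieldType) (F : {mpoly K[3]}) : set (point K) :=
  [set P | forall u : 'rV[K]_3, u \in point_space P -> F.@[fun i => u 0 i] = 0].

(* l is the projective tangent line sum_i (dF/dX_i)(u) X_i = 0 to the curve
   F = 0 at its point P = [u]. As l is a line, this forces P to be a nonsingular
   point of the curve. *)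
Definition tangent_at (K : fieldType) (F : {mpoly K[3]}) (P : point K)
    (l : line K) : Prop :=
  zeros F P /\
  forall u : 'rV[K]_3, u \in point_space P -> u != 0 ->
    forall v : 'rV[K]_3,
      (v \in line_space l) =
        (\sum_(i < 3) (F^`M(i)).@[fun j => u 0 j] * v 0 i == 0).

(* star l1 l2 l3 is a contact star configuration on the conic F = 0. *)
Definition contact_star (K : fieldType) (F : {mpoly K[3]})
    (l1 l2 l3 : line K) : Prop :=
  ~ concurrent l1 l2 l3 /\
  exists P1 P2 P3 : point K,
    uniq [:: P1; P2; P3] /\
    [/\ tangent_at F P1 l1, tangent_at F P2 l2 & tangent_at F P3 l3].

(* Main.v *)
(* A line tangent to the conic is given by a parameter a in P^1, and a point of
   the plane by the binary quadratic form whose roots are the parameters of the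
   tangent lines through it.  A contact star is then the set of the three
   quadratic factors of a binary cubic, and the conic through the stars of f and
   g is { q : f and g are proportional modulo q }, i.e. the Bezoutian of f and
   g, which vanishes at q if and only if f, g, s q, t q are linearly dependent.
   Three cubics f, g, h are annihilated by a common nonzero functional phi on
   cubics.  The two conditions phi(s q) = phi(t q) = 0 on the three coefficients
   of q have a nonzero solution; for it f, g, s q, t q are linearly dependent,
   and likewise with g, h and f, h, so q lies on the three conics. *)
Require Import Defs.
From HB Require Import structures.
From mathcomp Require Import all_boot all_order all_algebra.
From mathcomp Require Import ring.
From mathcomp Require Import boolp classical_sets reals.
From mathcomp Require Import complex.
From mathcomp Require Import mpoly.

Set Implicit Arguments.
Unset Strict Implicit.
Unset Printing Implicit Defensive.

Import GRing.Theory.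
Local Open Scope ring_scope.
Local Open Scope classical_set_scope.

(** * Bilinear forms given by square matrices *)

Definition bilin (K : fieldType) (n : nat) (M : 'M[K]_n) (u v : 'rV[K]_n) : K :=
  (u *m M *m v^T) 0 0.

Section Bilin.
Variables (K : fieldType) (n : nat).
Implicit Types (S M : 'M[K]_n) (u v w : 'rV[K]_n).

Lemma bilinE M u v :
  bilin M u v = \sum_i \sum_j M i j * (u 0 i * v 0 j).
Proof.
rewrite /bilin -mulmxA mxE; apply: eq_bigr => i _.
rewrite mxE mulr_sumr; apply: eq_bigr => j _; rewrite mxE; ring.
Qed.

Lemma bilinDl M u v w : bilin M (u + v) w = bilin M u w + bilin M v w.
Proof. by rewrite /bilin !mulmxDl mxE. Qed.

Lemma bilinDr M u v w : bilin M w (u + v) = bilin M w u + bilin M w v.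
Proof. by rewrite /bilin linearD mulmxDr mxE. Qed.

Lemma bilinZl M k u w : bilin M (k *: u) w = k * bilin M u w.
Proof. by rewrite /bilin -!scalemxAl mxE. Qed.

Lemma bilinZr M k u w : bilin M w (k *: u) = k * bilin M w u.
Proof. by rewrite /bilin linearZ -scalemxAr mxE. Qed.

Lemma bilin_sym S u v : S^T = S -> bilin S u v = bilin S v u.
Proof.
move=> symS; rewrite /bilin -[in LHS](trmxK (u *m S *m v^T)) mxE.
by rewrite !trmx_mul trmxK symS mulmxA.
Qed.

End Bilin.

(** * Binary quadratics and cubics, and the Bezoutian of two cubics *)

Definition bracket (K : fieldType) (a b : K * K) : K :=
  a.1 * b.2 - a.2 * b.1.

Definition binary_form (K : fieldType) (d : nat) (f : 'rV[K]_d.+1)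
    (a : K * K) : K :=
  \sum_(i < d.+1) f 0 i * (a.1 ^+ (d - i) * a.2 ^+ i).

(** The coefficients of the product of the linear forms [bracket x a] and [bracket x b] in [x], that
    is, of the quadratic with roots [a] and [b]; [prod3] is the analogous cubic. *)
Definition prod2 (K : fieldType) (a b : K * K) : 'rV[K]_3 :=
  \row_(i < 3) [:: a.2 * b.2; - (a.1 * b.2 + a.2 * b.1); a.1 * b.1]`_i.

Definition prod3 (K : fieldType) (a b c : K * K) : 'rV[K]_4 :=
  \row_(i < 4) [:: a.2 * b.2 * c.2;
    - (a.1 * b.2 * c.2 + a.2 * b.1 * c.2 + a.2 * b.2 * c.1);
    a.1 * b.1 * c.2 + a.1 * b.2 * c.1 + a.2 * b.1 * c.1;
    - (a.1 * b.1 * c.1)]`_i.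

Definition mulX (K : fieldType) (q : 'rV[K]_3) : 'rV[K]_4 :=
  row_mx q (0 : 'rV_1).
Definition mulY (K : fieldType) (q : 'rV[K]_3) : 'rV[K]_4 :=
  row_mx (0 : 'rV_1) q.

Section BinaryForms.
Variable K : fieldType.
Implicit Types (a b c x : K * K) (q : 'rV[K]_3).

Lemma binary_formD d (f g : 'rV[K]_d.+1) x :
  binary_form (f + g) x = binary_form f x + binary_form g x.
Proof.
rewrite /binary_form; under eq_bigr do rewrite mxE mulrDl.
by rewrite big_split.
Qed.

Lemma binary_formZ d k (f : 'rV[K]_d.+1) x :
  binary_form (k *: f) x = k * binary_form f x.
Proof.
rewrite /binary_form mulr_sumr; apply: eq_bigr => i _.
by rewrite mxE -mulrA.
Qed.

Lemma binary_form0 d x : binary_form (0 : 'rV[K]_d.+1) x = 0.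
Proof. by rewrite -(scale0r 0) binary_formZ mul0r. Qed.

Lemma binary_form_prod2 a b x :
  binary_form (prod2 a b) x = bracket x a * bracket x b.
Proof.
rewrite /binary_form !big_ord_recl big_ord0 !mxE /= /bracket.
ring.
Qed.

Lemma binary_form_prod3 a b c x :
  binary_form (prod3 a b c) x = bracket x a * bracket x b * bracket x c.
Proof.
rewrite /binary_form !big_ord_recl big_ord0 !mxE /= /bracket.
ring.
Qed.

Lemma binary_form_mulX q x : binary_form (mulX q) x = x.1 * binary_form q x.
Proof.
have e3 : mulX q 0 ord_max = 0.
  have -> : ord_max = rshift 3 (0 : 'I_1) by apply: val_inj.
  by rewrite (@row_mxEr _ 1 3 1) mxE.
have ei (i : 'I_3) : mulX q 0 (widen_ord (leqnSn 3) i) = q 0 i.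
  have -> : widen_ord (leqnSn 3) i = lshift 1 i by apply: val_inj.
  exact: (@row_mxEl _ 1 3 1).
rewrite /binary_form big_ord_recr /= e3 mul0r addr0 mulr_sumr.
apply: eq_bigr => i _; rewrite ei /= subSn ?exprS; last by rewrite -ltnS.
ring.
Qed.

Lemma binary_form_mulY q x : binary_form (mulY q) x = x.2 * binary_form q x.
Proof.
have e0 : mulY q 0 ord0 = 0.
  have -> : ord0 = lshift 3 (0 : 'I_1) by apply: val_inj.
  by rewrite (@row_mxEl _ 1 1 3) mxE.
have ei (i : 'I_3) : mulY q 0 (lift ord0 i) = q 0 i.
  have -> : lift ord0 i = rshift 1 i by apply: val_inj.
  exact: (@row_mxEr _ 1 1 3).
rewrite /binary_form big_ord_recl /= e0 mul0r add0r mulr_sumr.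
apply: eq_bigr => i _; rewrite ei /bump /= add1n subSS exprS.
ring.
Qed.

(** Lagrange interpolation at [a], [b], [c] with cleared denominators: each product of two linear
    factors vanishes at two of the three nodes. *)
Lemma interpolation2 q a b c :
  (bracket a b * bracket a c * bracket b c) *: q =
    (binary_form q a * bracket b c) *: prod2 b c
    + (- (binary_form q b * bracket a c)) *: prod2 a c
    + (binary_form q c * bracket a b) *: prod2 a b.
Proof.
apply/rowP => i; rewrite /binary_form !big_ord_recl !big_ord0 /bracket !mxE.
case: i => [[|[|[|//]]] lti] /=.
- have -> : Ordinal lti = ord0 by apply: val_inj.
  ring.
- have -> : Ordinal lti = lift ord0 ord0 by apply: val_inj.
  ring.
- have -> : Ordinal lti = lift ord0 (lift ord0 ord0) by apply: val_inj.
  ring.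
Qed.

Lemma bracket_proportional a b : a != 0 -> b != 0 -> bracket a b = 0 ->
  exists2 k, k != 0 & b = (k * a.1, k * a.2).
Proof.
case: a b => [a1 a2] [b1 b2]; rewrite /bracket /= -!pair_eqE /pair_eq /=.
rewrite !negb_and.
move=> a0 b0 e.
have [a10|a10] := eqVneq a1 0.
  move: a0 e; rewrite a10 eqxx /= mul0r sub0r => a20 /eqP.
  rewrite oppr_eq0 mulf_eq0 (negPf a20) /= => /eqP b10.
  exists (b2 / a2); last by rewrite b10 mulr0 divfK.
  by move: b0; rewrite b10 eqxx /= => b20; rewrite mulf_neq0 ?invr_eq0.
have e2 : b2 = b1 / a1 * a2.
  apply: (mulfI a10); rewrite mulrA (mulrC a1 (b1 / a1)) divfK //.
  by apply/eqP; rewrite -subr_eq0 (mulrC b1) e.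
exists (b1 / a1); last by rewrite -e2 divfK.
rewrite mulf_neq0 ?invr_eq0 //; apply: contraTneq b0 => b10.
by rewrite e2 b10 eqxx mul0r mul0r eqxx.
Qed.

Lemma bracketC a b : bracket a b = - bracket b a.
Proof. rewrite /bracket; ring. Qed.

(* The form has only mixed terms in the basis given by the three products; the
   coordinates of [q] in this basis are, up to brackets, its values at [a], [b]
   and [c]. *)
Lemma quadratic_form_star (N : 'M[K]_3) a b c :
  bilin N (prod2 a b) (prod2 a b) = 0 ->
  bilin N (prod2 a c) (prod2 a c) = 0 ->
  bilin N (prod2 b c) (prod2 b c) = 0 ->
  exists al be ga : K, forall q,
    (bracket a b * bracket a c * bracket b c) ^+ 2 * bilin N q q =
      al * binary_form q b * binary_form q c
      + be * binary_form q a * binary_form q c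
      + ga * binary_form q a * binary_form q b.
Proof.
move=> Nab Nac Nbc.
(* [N] need not be symmetric, so the two mixed values of each pair are added. Each witness is the
   product of two brackets from [interpolation2] with the mixed value of the corresponding two
   products. *)
pose P u v := bilin N u v + bilin N v u.
exists (- (bracket a c * bracket a b) * P (prod2 a c) (prod2 a b)).
exists ((bracket b c * bracket a b) * P (prod2 b c) (prod2 a b)).
exists (- (bracket b c * bracket a c) * P (prod2 b c) (prod2 a c)).
move=> q; set V := _ * bracket b c.
have -> : V ^+ 2 * bilin N q q = bilin N (V *: q) (V *: q).
  by rewrite /bilin linearZ /= -!scalemxAl -scalemxAr !mxE mulrA.
rewrite interpolation2 /P.
rewrite !(bilinDl, bilinDr, bilinZl, bilinZr) Nab Nac Nbc.
ring.
Qed.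

(** The four cubics lie in the hyperplane of a 4-dimensional space on which [phi] vanishes. *)
Lemma common_annihilator_dep (f g p r : 'rV[K]_4) (phi : 'cV[K]_4) :
  phi != 0 -> f *m phi = 0 -> g *m phi = 0 -> p *m phi = 0 -> r *m phi = 0 ->
  exists x y z w : K, ~ [/\ x = 0, y = 0, z = 0 & w = 0] /\
    x *: f + y *: g + z *: p + w *: r = 0.
Proof.
move=> phi0 f0 g0 p0 r0.
pose A : 'M[K]_4 := \matrix_(i < 4) [:: f; g; p; r]`_i.
have A0 : A *m phi = 0.
  apply/row_matrixP => i; rewrite row_mul rowK row0.
  by case: i => [[|[|[|[|//]]]] ?].
have : \det A == 0.
  rewrite -det_tr; apply/det0P; exists phi^T; first by rewrite trmx_eq0.
  by rewrite -trmx_mul A0 trmx0.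
case/det0P => v v0; rewrite mulmx_sum_row !big_ord_recl big_ord0 !rowK /= => e.
exists (v 0 ord0), (v 0 (lift ord0 ord0)), (v 0 (lift ord0 (lift ord0 ord0))).
exists (v 0 (lift ord0 (lift ord0 (lift ord0 ord0)))).
split; last by rewrite -[RHS]e addr0 !addrA.
case=> x0 y0 z0 w0; case/eqP: v0; apply/rowP => i; rewrite mxE.
case: i => [[|[|[|[|//]]]] lti]; [rewrite -[RHS]x0|rewrite -[RHS]y0|
  rewrite -[RHS]z0|rewrite -[RHS]w0]; congr (v _ _); exact: val_inj.
Qed.

(* The expression is, up to sign and the three brackets of [a], [b], [c], the
   determinant of the forms [prod3 a b c], [g], [mulX q], [mulY q]. *)
Lemma bezoutian_vanish a b c (g : 'rV[K]_4) q (phi : 'cV[K]_4) x :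
  phi != 0 -> prod3 a b c *m phi = 0 -> g *m phi = 0 ->
  mulX q *m phi = 0 -> mulY q *m phi = 0 ->
  binary_form (prod3 a b c) x != 0 ->
  bracket b c * binary_form g a * binary_form q b * binary_form q c
  - bracket a c * binary_form g b * binary_form q a * binary_form q c
  + bracket a b * binary_form g c * binary_form q a * binary_form q b = 0.
Proof.
move=> phi0 f0 g0 X0 Y0 fx.
have [k [y [z [w [nz e]]]]] := common_annihilator_dep phi0 f0 g0 X0 Y0.
(* The linear dependence, read as an identity of functions of the parameter [p]. *)
have ev p : k * binary_form (prod3 a b c) p + y * binary_form g p
    + (z * p.1 + w * p.2) * binary_form q p = 0.
  rewrite mulrDl -!mulrA -binary_form_mulX -binary_form_mulY addrA.
  by rewrite -!binary_formZ -!binary_formD e binary_form0.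
have ea := ev a; have eb := ev b; have ec := ev c.
have f_a : binary_form (prod3 a b c) a = 0.
  by rewrite binary_form_prod3 /bracket; ring.
have f_b : binary_form (prod3 a b c) b = 0.
  by rewrite binary_form_prod3 /bracket; ring.
have f_c : binary_form (prod3 a b c) c = 0.
  by rewrite binary_form_prod3 /bracket; ring.
move: ea eb ec; rewrite f_a f_b f_c !mulr0 !add0r.
set ga := binary_form g a; set gb := binary_form g b; set gc := binary_form g c.
set qa := binary_form q a; set qb := binary_form q b; set qc := binary_form q c.
(* At its roots [a], [b], [c] the first cubic drops out, which leaves three linear equations in [y],
   [z], [w] with determinant [T]. If [T] were nonzero, all three unknowns would vanish by Cramer's
   rule; the combinations below have the cofactors of one column as coefficients. *)
move=> ea eb ec; set T := _ + _.
apply/eqP; apply: contra_notT nz => T0.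
have y0 : y = 0.
  apply: (mulfI T0); rewrite mulr0.
  transitivity (bracket b c * qb * qc * (y * ga + (z * a.1 + w * a.2) * qa)
    - bracket a c * qa * qc * (y * gb + (z * b.1 + w * b.2) * qb)
    + bracket a b * qa * qb * (y * gc + (z * c.1 + w * c.2) * qc)).
    by rewrite /T /bracket; ring.
  by rewrite ea eb ec; ring.
have z0 : z = 0.
  apply: (mulfI T0); rewrite mulr0.
  transitivity ((z * a.1 + w * a.2) * qa * (b.2 * gc * qb - c.2 * gb * qc)
    - (z * b.1 + w * b.2) * qb * (a.2 * gc * qa - c.2 * ga * qc)
    + (z * c.1 + w * c.2) * qc * (a.2 * gb * qa - b.2 * ga * qb)).
    by rewrite /T /bracket; ring.
  by move: ea eb ec; rewrite y0 !mul0r !add0r => -> -> ->; ring.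
have w0 : w = 0.
  apply: (mulfI T0); rewrite mulr0.
  transitivity ((z * a.1 + w * a.2) * qa * (c.1 * gb * qc - b.1 * gc * qb)
    + (z * b.1 + w * b.2) * qb * (a.1 * gc * qa - c.1 * ga * qc)
    - (z * c.1 + w * c.2) * qc * (a.1 * gb * qa - b.1 * ga * qb)).
    by rewrite /T /bracket; ring.
  by move: ea eb ec; rewrite y0 !mul0r !add0r => -> -> ->; ring.
(* Only the multiple [k] of the first cubic is left, and this cubic is nonzero at [x]; so [k]
   vanishes too and the dependence is trivial. *)
move: (ev x); rewrite y0 z0 w0 !(mul0r, addr0) => /eqP.
by rewrite mulf_eq0 (negPf fx) orbF => /eqP.
Qed.

(** The five vanishing conditions make the quadratic form of [N] a multiple of the Bezoutian of the
    two cubics, which vanishes at [q] by [bezoutian_vanish]. *)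
Lemma vanish_at_common_root (N : 'M[K]_3) a b c a' b' c' q (phi : 'cV[K]_4) :
  (forall x y, x \in [:: a; b; c] -> y \in [:: a'; b'; c'] ->
    bracket x y != 0) ->
  bracket a b != 0 -> bracket a c != 0 -> bracket b c != 0 ->
  bracket a' b' != 0 -> 
  bilin N (prod2 a b) (prod2 a b) = 0 ->
  bilin N (prod2 a c) (prod2 a c) = 0 ->
  bilin N (prod2 b c) (prod2 b c) = 0 ->
  bilin N (prod2 a' c') (prod2 a' c') = 0 ->
  bilin N (prod2 b' c') (prod2 b' c') = 0 ->
  phi != 0 -> prod3 a b c *m phi = 0 -> prod3 a' b' c' *m phi = 0 ->
  mulX q *m phi = 0 -> mulY q *m phi = 0 ->
  bilin N q q = 0.
Proof.
move=> disj ab ac bc a'b' Nab Nac Nbc Nac' Nbc' phi0 f0 g0 X0 Y0.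
have [al [be [ga E]]] := quadratic_form_star Nab Nac Nbc.
have faa' : binary_form (prod3 a b c) a' != 0.
  rewrite binary_form_prod3 !(bracketC a') !mulf_neq0 // oppr_eq0;
  by apply: disj; rewrite !inE eqxx ?orbT.
have T0 := bezoutian_vanish phi0 f0 g0 X0 Y0 faa'.
move: T0; rewrite !binary_form_prod3.
set Ga := _ * bracket a c'; set Gb := _ * bracket b c'.
set Gc := _ * bracket c c'.
move=> T0.
(* With these weights, the condition at the product of two of the primed parameters, multiplied by
   the brackets of [a], [b], [c] with the third one, becomes linear in that third parameter. *)
pose A := al * Gb * Gc; pose B := be * Ga * Gc; pose C := ga * Ga * Gb.
have ea' : A * bracket a a' + B * bracket b a' + C * bracket c a' = 0.
  have := E (prod2 b' c'); rewrite Nbc' mulr0 !binary_form_prod2 => e.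
  transitivity (0 * (bracket a a' * bracket b a' * bracket c a')); last by ring.
  by rewrite [in RHS]e /A /B /C /Ga /Gb /Gc; ring.
have eb' : A * bracket a b' + B * bracket b b' + C * bracket c b' = 0.
  have := E (prod2 a' c'); rewrite Nac' mulr0 !binary_form_prod2 => e.
  transitivity (0 * (bracket a b' * bracket b b' * bracket c b')); last by ring.
  by rewrite [in RHS]e /A /B /C /Ga /Gb /Gc; ring.
(* A linear form in [x] that vanishes at the independent parameters [a'] and [b'] is zero. Its
   values at [c] and [b] then determine the ratios of [A], [B], [C] as those of [bracket b c],
   [- bracket a c], [bracket a b]. *)
have lin x : A * bracket a x + B * bracket b x + C * bracket c x = 0.
  apply: (mulfI a'b'); rewrite mulr0.
  transitivity (bracket x b'
      * (A * bracket a a' + B * bracket b a' + C * bracket c a')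
    + bracket a' x * (A * bracket a b' + B * bracket b b' + C * bracket c b')).
    by rewrite /bracket; ring.
  by rewrite ea' eb' !mulr0 addr0.
have eB : B * bracket b c = - A * bracket a c.
  have := lin c; rewrite (_ : bracket c c = 0); last by rewrite /bracket; ring.
  by rewrite mulr0 addr0 addrC => /eqP; rewrite addr_eq0 mulNr => /eqP.
have eC : C * bracket b c = A * bracket a b.
  have := lin b; rewrite (_ : bracket b b = 0); last by rewrite /bracket; ring.
  rewrite mulr0 addr0 (bracketC c) mulrN => /eqP.
  by rewrite subr_eq0 => /eqP.
have Gn x : x \in [:: a; b; c] ->
    bracket x a' * bracket x b' * bracket x c' != 0.
  by move=> xin; rewrite !mulf_neq0 // disj // !inE eqxx ?orbT.
have Ga0 : Ga != 0 by apply: Gn; rewrite !inE eqxx ?orbT.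
have Gb0 : Gb != 0 by apply: Gn; rewrite !inE eqxx ?orbT.
have Gc0 : Gc != 0 by apply: Gn; rewrite !inE eqxx ?orbT.
set V := bracket a b * bracket a c * bracket b c in E.
have W0 : Ga * Gb * Gc * bracket b c * V ^+ 2 != 0.
  have V0 : V != 0 by rewrite /V !mulf_neq0.
  apply: mulf_neq0 (expf_neq0 2 V0).
  exact: mulf_neq0 (mulf_neq0 (mulf_neq0 Ga0 Gb0) Gc0) bc.
apply: (mulfI W0); rewrite -[LHS]mulrA E mulr0.
(* After substitution of the ratios this is [A] times the Bezoutian expression in [T0]. *)
transitivity (A * bracket b c * Ga * binary_form q b * binary_form q c
  + B * bracket b c * Gb * binary_form q a * binary_form q c
  + C * bracket b c * Gc * binary_form q a * binary_form q b).
  by rewrite /A /B /C; ring.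
rewrite eB eC.
rewrite -[RHS](mulr0 A) -T0; ring.
Qed.

Lemma exists_right_kernel m n (A : 'M[K]_(m, n)) : (m < n)%N ->
  exists2 v : 'cV[K]_n, v != 0 & A *m v = 0.
Proof.
move=> mn; have : kermx A^T != 0.
  rewrite kermx_eq0 /row_free mxrank_tr neq_ltn; apply/orP; left.
  exact: leq_ltn_trans (rank_leq_row A) mn.
case/rowV0Pn => w /sub_kermxP wA w0; exists w^T; first by rewrite trmx_eq0.
by apply: trmx_inj; rewrite trmx_mul trmxK wA trmx0.
Qed.

(* Every net of binary cubics contains the pencil of multiples of a quadratic:
   this quadratic is the common point of the three conics. *)
Lemma exists_common_root (f g h : 'rV[K]_4) :
  exists (phi : 'cV[K]_4) (q : 'rV[K]_3),
    [/\ phi != 0, q != 0, f *m phi = 0, g *m phi = 0 & h *m phi = 0] /\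
    mulX q *m phi = 0 /\ mulY q *m phi = 0.
Proof.
have [phi phi0 e] := @exists_right_kernel (1 + (1 + 1)) 4
  (col_mx f (col_mx g h)) isT.
move/eqP: e; rewrite !mul_col_mx !col_mx_eq0.
case/and3P => /eqP f0 /eqP g0 /eqP h0.
(* Dropping the last or the first entry of [phi] gives the functionals that send [q] to the values
   of [phi] at [mulX q] and [mulY q]: two equations in three unknowns. *)
pose phi1 := usubmx (m1 := 3) (m2 := 1) phi.
pose phi2 := dsubmx (m1 := 1) (m2 := 3) phi.
have [q q0 e] := @exists_right_kernel (1 + 1) 3 (row_mx phi1 phi2)^T isT.
exists phi, q^T; split; first by split; rewrite ?trmx_eq0.
move/eqP: e; rewrite (tr_row_mx phi1 phi2) mul_col_mx col_mx_eq0.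
case/andP => /eqP e1 /eqP e2.
rewrite -[phi in mulX _ *m phi](vsubmxK (m1 := 3) (m2 := 1)).
rewrite -[phi in mulY _ *m phi](vsubmxK (m1 := 1) (m2 := 3)).
rewrite /mulX /mulY (mul_row_col (n1 := 3)) (mul_row_col (n1 := 1)).
rewrite !mul0mx addr0 add0r.
by split; apply: trmx_inj; rewrite trmx_mul trmxK trmx0 ?e1 ?e2.
Qed.

End BinaryForms.

(** * Quadratic forms as polynomials, and their gradients *)

Lemma mpolyX_deg2 (n : nat) (K : fieldType) (m : 'X_{1..n}) : mdeg m = 2%N ->
  exists i j, 'X_[m] = 'X_i * 'X_j :> {mpoly K[n]}.
Proof.
move=> m2; have [i mi] : exists i, m i != 0%N.
  apply/existsP; move: m2; apply: contra_eqT => /existsPn m0.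
  by rewrite mdegE big1 // => i _; apply/eqP; have := m0 i; rewrite negbK.
have le_im : (U_(i) <= m)%MM.
  by apply/mnm_lepP => j; rewrite mnm1E; case: eqP => [<-|//]; rewrite lt0n.
have : mdeg (m - U_(i)) = 1%N.
  by apply/eqP; rewrite -(eqn_add2r (mdeg U_(i))) -mdegD submK // mdeg1 m2.
move/eqP/mdeg1P => [j /eqP mj].
by exists i, j; rewrite -mpolyXD -mj addmC submK.
Qed.

(** Each monomial is put into a single entry, without halving mixed coefficients, so the matrix
    constructed is in general not symmetric. *)
Lemma homog2_matrix (n : nat) (K : fieldType) (F : {mpoly K[n]}) :
  F \is 2.-homog ->
  exists M : 'M[K]_n, F = \sum_i \sum_j M i j *: ('X_i * 'X_j).
Proof.
move=> /dhomogP homF; rewrite [F]mpolyE big_seq.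
apply: (big_ind (fun p : {mpoly K[n]} =>
  exists M : 'M[K]_n, p = \sum_i \sum_j M i j *: ('X_i * 'X_j))).
- exists 0; rewrite big1 // => i _; rewrite big1 // => j _.
  by rewrite mxE scale0r.
- move=> _ _ [M ->] [N ->]; exists (M + N); rewrite -big_split /=.
  apply: eq_bigr => i _; rewrite -big_split /=; apply: eq_bigr => j _.
  by rewrite mxE scalerDl.
move=> m /homF m2; have [i [j ->]] := @mpolyX_deg2 n K m m2.
exists (F@_m *: delta_mx i j).
rewrite (bigD1 i) //= [X in _ = _ + X]big1 ?addr0; last first.
  move=> i' ne; rewrite big1 // => j' _.
  by rewrite !mxE (negPf ne) mulr0 scale0r.
rewrite (bigD1 j) //= [X in _ = _ + X]big1 ?addr0; last first.
  by move=> j' ne; rewrite !mxE (negPf ne) andbF mulr0 scale0r.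
by rewrite !mxE !eqxx mulr1.
Qed.

Lemma meval_quadratic (K : fieldType) (n : nat) (M : 'M[K]_n) (u : 'rV[K]_n) :
  (\sum_i \sum_j M i j *: ('X_i * 'X_j) : {mpoly K[n]}).@[fun i => u 0 i] =
  bilin M u u.
Proof.
rewrite bilinE raddf_sum; apply: eq_bigr => i _.
rewrite raddf_sum; apply: eq_bigr => j _ /=.
by rewrite mevalZ mevalM !mevalXU.
Qed.

Lemma mderivXU (K : fieldType) (n : nat) (i k : 'I_n) :
  ('X_i)^`M(k) = (i == k)%:R :> {mpoly K[n]}.
Proof.
rewrite mderivX mnm1E; case: eqP => [->|_]; last by rewrite scale0r.
by rewrite -{1}[X in (X - _)%MM]add0m addmK mpolyX0 scale1r.
Qed.

(** This turns tangency into polarity: the tangent line at [u] is the orthogonal of [u] for the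
    symmetric matrix [M + M^T]. *)
Lemma gradient_quadratic (K : fieldType) (n : nat) (M : 'M[K]_n)
    (u v : 'rV[K]_n) :
  \sum_(k < n) ((\sum_i \sum_j M i j *: ('X_i * 'X_j) : {mpoly K[n]})^`M(k)).@[
     fun i => u 0 i] * v 0 k = bilin (M + M^T) u v.
Proof.
pose G i j k := M i j * ((i == k)%:R * u 0 j + u 0 i * (j == k)%:R) * v 0 k.
transitivity (\sum_k \sum_i \sum_j G i j k).
  apply: eq_bigr => k _; rewrite (raddf_sum (mderiv k)) raddf_sum mulr_suml.
  apply: eq_bigr => i _ /=.
  rewrite (raddf_sum (mderiv k)) raddf_sum mulr_suml.
  apply: eq_bigr => j _ /=; rewrite /G.
  rewrite mderivZ mevalZ mderivM mevalD !mevalM.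
  by rewrite !mevalXU !mderivXU !rmorph_nat.
have delta_sum (i : 'I_n) (h : 'I_n -> K) : \sum_k (i == k)%:R * h k = h i.
  rewrite (bigD1 i) //= eqxx mul1r big1 ?addr0 // => k ne.
  by rewrite eq_sym (negPf ne) mul0r.
transitivity (\sum_i \sum_j M i j * (u 0 j * v 0 i + u 0 i * v 0 j)).
  rewrite exchange_big; apply: eq_bigr => i _ /=.
  rewrite exchange_big; apply: eq_bigr => j _ /=.
  rewrite -(delta_sum i (fun k => u 0 j * v 0 k)).
  rewrite -(delta_sum j (fun k => u 0 i * v 0 k)).
  rewrite -big_split mulr_sumr /=; apply: eq_bigr => k _; rewrite /G; ring.
rewrite bilinE; under eq_bigr do under eq_bigr do rewrite mulrDr.
under eq_bigr do rewrite big_split.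
rewrite big_split /= exchange_big -big_split /=; apply: eq_bigr => i _.
rewrite -big_split /=; apply: eq_bigr => j _; rewrite !mxE; ring.
Qed.

(** * Rational parametrization of a conic from a basis of isotropic vectors *)

Section IsotropicBasis.
Variable K : fieldType.
Implicit Types (S : 'M[K]_3) (u v x y z : 'rV[K]_3).

(** A nondegenerate form on a 3-dimensional space has no totally isotropic plane. If [x] and [y]
    were orthogonal, the combination of them orthogonal to [z] would be orthogonal to everything,
    hence zero; then [x] is orthogonal to [z] as well, so [x] is zero. *)
Lemma isotropic_pairing S x y z : S^T = S ->
  (forall v, bilin S x v = 0 -> bilin S y v = 0 -> bilin S z v = 0 -> v = 0) ->
  (forall k l, k *: x + l *: y = 0 -> k = 0 /\ l = 0) ->
  bilin S x x = 0 -> bilin S y y = 0 -> bilin S x y != 0.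
Proof.
move=> symS ker indep xx yy; apply/eqP => xy.
have yx : bilin S y x = 0 by rewrite bilin_sym.
have [r0 q0] : bilin S y z = 0 /\ - bilin S x z = 0.
  apply: indep; apply: ker; rewrite bilinDr !bilinZr.
  - by rewrite xx xy !mulr0 addr0.
  - by rewrite yx yy !mulr0 addr0.
  by rewrite (bilin_sym y z symS) (bilin_sym x z symS) mulNr mulrC subrr.
have x0 : x = 0.
  by apply: ker => //; rewrite bilin_sym //; apply/eqP; rewrite -oppr_eq0 q0.
have [/eqP] : 1 = 0 :> K /\ 0 = 0 :> K.
  by apply: indep; rewrite x0 scaler0 scale0r addr0.
by rewrite oner_eq0.
Qed.

Lemma unitmx_ker n (A : 'M[K]_n) :
  (forall v : 'rV_n, v *m A = 0 -> v = 0) -> A \in unitmx.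
Proof.
move=> ker; rewrite unitmxE unitfE; apply/det0P => -[v v0 /ker] /eqP.
by rewrite (negPf v0).
Qed.

(* In the basis of isotropic vectors [row i U], rescaled so that all mixed
   products agree, the dual conic is [x y + x z + y z = 0], with the rational
   parametrization [(- t (s + t), - s (s + t), s t)]. *)
Lemma isotropic_parametrization S (U : 'M[K]_3) : 2%:R != 0 :> K -> S^T = S ->
  U \in unitmx -> S \in unitmx ->
  (forall i, bilin S (row i U) (row i U) = 0) ->
  exists2 C : 'M[K]_3, C \in unitmx &
    forall u, u != 0 -> bilin S u u = 0 ->
    exists (a : K * K) (k : K), [/\ a != 0, k != 0 &
      forall v, bilin S u v = k * binary_form (v *m C) a].
Proof.
move=> two0 symS unitU unitS iso.
pose i1 : 'I_3 := lift ord0 ord0; pose i2 : 'I_3 := lift ord0 (lift ord0 ord0).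
pose u0 := row ord0 U; pose u1 := row i1 U; pose u2 := row i2 U.
have comb v : v *m U = v 0 ord0 *: u0 + v 0 i1 *: u1 + v 0 i2 *: u2.
  by rewrite mulmx_sum_row !big_ord_recl big_ord0 addr0 addrA.
have ker v : bilin S u0 v = 0 -> bilin S u1 v = 0 -> bilin S u2 v = 0 -> v = 0.
  move=> v0 v1 v2; have : U *m S *m v^T = 0.
    apply/colP => i; rewrite [RHS]mxE.
    have -> : (U *m S *m v^T) i 0 = bilin S (row i U) v.
      by rewrite /bilin -!row_mul [RHS]mxE.
    case: i => [[|[|[|//]]] lti]; [rewrite -[RHS]v0|rewrite -[RHS]v1|
      rewrite -[RHS]v2]; congr (bilin _ (row _ _) _); exact: val_inj.
  move/(congr1 (mulmx (invmx (U *m S)))).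
  rewrite mulmx0 mulKmx ?unitmx_mul ?unitU //.
  by move/(congr1 trmx); rewrite trmxK trmx0.
have indep k l m : k *: u0 + l *: u1 + m *: u2 = 0 -> [/\ k = 0, l = 0 & m = 0].
  pose v : 'rV[K]_3 := \row_(i < 3) [:: k; l; m]`_i.
  have -> : k *: u0 + l *: u1 + m *: u2 = v *m U by rewrite comb !mxE.
  move/(congr1 (mulmxr (invmx U))); rewrite /= mul0mx mulmxK // => v0.
  have vi i : v 0 i = 0 by rewrite v0 mxE.
  by move: (vi ord0) (vi i1) (vi i2); rewrite !mxE.
have iso0 : bilin S u0 u0 = 0 := iso _.
have iso1 : bilin S u1 u1 = 0 := iso _.
have iso2 : bilin S u2 u2 = 0 := iso _.
pose p := bilin S u0 u1; pose q := bilin S u0 u2; pose r := bilin S u1 u2.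
have p0 : p != 0.
  apply: (isotropic_pairing (z := u2)) => // k l e.
  by have [] := indep k l 0; first by rewrite scale0r addr0.
have q0 : q != 0.
  apply: (isotropic_pairing (z := u1)) => // [v ? ? ?|k l e]; first exact: ker.
  by have [] := indep k 0 l; first by rewrite scale0r addr0.
have r0 : r != 0.
  apply: (isotropic_pairing (z := u0)) => // [v ? ? ?|k l e]; first exact: ker.
  by have [] := indep 0 k l; first by rewrite scale0r add0r.
(* The rows are the coefficients of [s ^+ 2], [s * t], [t ^+ 2] in the parametrized isotropic
   vector, so the entries of [v *m C] are those of its pairing with [v]. *)
pose D : 'M[K]_3 := \matrix_(i < 3)
  [:: - q *: u1; p *: u2 + - q *: u1 + - r *: u0; - r *: u0]`_i.
pose C := S *m D^T.
have CE v j : (v *m C) 0 j = bilin S (row j D) v.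
  rewrite bilin_sym // /bilin /C mulmxA [RHS]mxE [LHS]mxE.
  by apply: eq_bigr => i _; rewrite !mxE.
have C0 v : (v *m C) 0 ord0 = - q * bilin S u1 v.
  by rewrite CE rowK /= bilinZl.
have C1 v : (v *m C) 0 i1 =
    p * bilin S u2 v - q * bilin S u1 v - r * bilin S u0 v.
  by rewrite CE rowK /= !bilinDl !bilinZl !mulNr.
have C2 v : (v *m C) 0 i2 = - r * bilin S u0 v.
  by rewrite CE rowK /= bilinZl.
have form v s t : binary_form (v *m C) (s, t) =
    r * (- t * (s + t)) * bilin S u0 v + q * (- s * (s + t)) * bilin S u1 v
    + p * (s * t) * bilin S u2 v.
  by rewrite /binary_form !big_ord_recl big_ord0 C0 C1 C2 /=; ring.
exists C.
  apply: unitmx_ker => v vC.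
  have e j : (v *m C) 0 j = 0 by rewrite vC mxE.
  have e1 : bilin S u1 v = 0.
    by apply/eqP; have /eqP := e ord0; rewrite C0 mulf_eq0 oppr_eq0 (negPf q0).
  have e0 : bilin S u0 v = 0.
    by apply/eqP; have /eqP := e i2; rewrite C2 mulf_eq0 oppr_eq0 (negPf r0).
  have e2 : bilin S u2 v = 0.
    apply/eqP; have /eqP := e i1; rewrite C1 e0 e1 !mulr0 !subr0.
    by rewrite mulf_eq0 (negPf p0).
  exact: ker.
move=> u un0 uu.
have [x [y [z ue]]] : exists x y z : K,
    u = (r * x) *: u0 + (q * y) *: u1 + (p * z) *: u2.
  have := comb (u *m invmx U); rewrite mulmxKV //; set c := _ *m _ => ->.
  exists (r^-1 * c 0 ord0), (q^-1 * c 0 i1), (p^-1 * c 0 i2).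
  by rewrite !mulVKf.
have uv v : bilin S u v =
    r * x * bilin S u0 v + q * y * bilin S u1 v + p * z * bilin S u2 v.
  by rewrite ue !bilinDl !bilinZl.
(* In these rescaled coordinates [bilin S u u] is [2 p q r] times the left-hand side. *)
have rel : x * y + x * z + y * z = 0.
  apply: (mulfI (mulf_neq0 two0 (mulf_neq0 p0 (mulf_neq0 q0 r0)))).
  rewrite mulr0 -uu uv ue !bilinDr !bilinZr iso0 iso1 iso2.
  rewrite (bilin_sym u1 u0) // (bilin_sym u2 u0) // (bilin_sym u2 u1) //.
  by rewrite -/p -/q -/r; ring.
(* If [x + y] is zero, the relation forces [x] and [y] to vanish, and the point has parameter
   [(1, -1)]. Otherwise [(s, t) = (y, x)] gives [- (x + y)] times the vector [(x, y, z)], because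
   [x y = - z (x + y)]. *)
have [xy|xy] := eqVneq (x + y) 0.
  have yx : y = - x by apply/eqP; rewrite -addr_eq0 addrC xy.
  have x0 : x = 0.
    apply/eqP; rewrite -[_ == 0]orbb -mulf_eq0 -oppr_eq0 -[X in _ == X]rel yx.
    by apply/eqP; ring.
  have z0 : z != 0.
    apply: contraNneq un0 => z0.
    by rewrite ue yx x0 z0 oppr0 !mulr0 !scale0r !addr0.
  exists (1, -1), (- z); split.
  - by rewrite -pair_eqE /pair_eq /= oner_eq0.
  - by rewrite oppr_eq0.
  by move=> v; rewrite uv form yx x0; ring.
exists (y, x), (- (x + y)^-1); split.
- rewrite -pair_eqE /pair_eq /= negb_and; apply: contraR xy.
  by rewrite negb_or !negbK => /andP [/eqP -> /eqP ->]; rewrite addr0.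
- by rewrite oppr_eq0 invr_eq0.
move=> v; rewrite form uv.
have -> : y * x = - (z * (x + y)).
  by apply/eqP; rewrite -addr_eq0; apply/eqP; rewrite -[RHS]rel; ring.
by field.
Qed.

End IsotropicBasis.

(** * Parameters of tangent lines, and the points of a star as binary quadratics *)

Section TangentLines.
Variable K : fieldType.
Implicit Types (F : {mpoly K[3]}) (P : Defs.point K).
Implicit Types (l m : line K) (a b : K * K).

Lemma point_vector P : exists2 u, u \in point_space P & u != 0.
Proof.
case: P => U /= dimU; exists (vpick U); first exact: memv_pick.
by rewrite vpick0 -dimv_eq0 (eqP dimU).
Qed.

Definition span_point (v : 'rV[K]_3) (v0 : v != 0) : Defs.point K :=
  Point (introT eqP (etrans (dim_vline v) (congr1 nat_of_bool v0))).

Lemma zeros_bilin F : conic F -> exists M : 'M[K]_3,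
  (forall P u, zeros F P -> u \in point_space P -> bilin M u u = 0) /\
  (forall u (u0 : u != 0), bilin M u u = 0 -> zeros F (span_point u0)).
Proof.
case=> _ /homog2_matrix [M ->]; exists M; split=> [P u FP uP|u u0 Mu v].
  by rewrite -meval_quadratic; exact: FP.
move=> /vlineP [k ->]; rewrite meval_quadratic.
by rewrite bilinZl bilinZr Mu !mulr0.
Qed.

Lemma tangent_bilin F (M : 'M[K]_3) P l :
  F = \sum_i \sum_j M i j *: ('X_i * 'X_j) -> tangent_at F P l ->
  exists u, [/\ u != 0, bilin (M + M^T) u u = 0 &
    forall v, (v \in line_space l) = (bilin (M + M^T) u v == 0)].
Proof.
move=> FE [FP tan]; have [u uP u0] := point_vector P.
exists u; split => // [|v]; last by rewrite (tan u uP u0) FE gradient_quadratic.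
have Mu : bilin M u u = 0 by rewrite -meval_quadratic -FE; exact: FP.
have -> : bilin (M + M^T) u u = bilin M u u + bilin M u u.
  rewrite [LHS]/bilin mulmxDr mulmxDl mxE; congr (_ + _).
  rewrite /bilin -[in RHS](trmxK (u *m M *m u^T)) [RHS]mxE.
  by rewrite !trmx_mul trmxK mulmxA.
by rewrite Mu addr0.
Qed.

(** Through [C] a vector of the plane is a binary quadratic; the line consists of the quadratics
    with root [a]. *)
Definition tangent_parameter (C : 'M[K]_3) l a : Prop :=
  a != 0 /\ forall v, (v \in line_space l) = (binary_form (v *m C) a == 0).

(** The contact points of the three tangents serve as isotropic basis. Since the tangents are not
    concurrent, these points are independent and the form [S] is nondegenerate. *)
Lemma exists_parametrization F l1 l2 l3 : 2%:R != 0 :> K ->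
  conic F -> contact_star F l1 l2 l3 ->
  exists2 C : 'M[K]_3, C \in unitmx & forall P l, tangent_at F P l ->
    exists a, tangent_parameter C l a.
Proof.
move=> two0 [_ /homog2_matrix [M FE]] [nconc [P1 [P2 [P3 [_ [t1 t2 t3]]]]]].
have [u1 [_ iso1 l1E]] := tangent_bilin FE t1.
have [u2 [_ iso2 l2E]] := tangent_bilin FE t2.
have [u3 [_ iso3 l3E]] := tangent_bilin FE t3.
set S := M + M^T in iso1 iso2 iso3 l1E l2E l3E.
have symS : S^T = S by rewrite /S linearD /= trmxK addrC.
pose U : 'M[K]_3 := \matrix_(i < 3) [:: u1; u2; u3]`_i.
have unitUS : U *m S \in unitmx.
  (* A nonzero vector orthogonal to the three contact points would span a point common to the three
     tangents. *)
  rewrite -unitmx_tr; apply: unitmx_ker => v vUS.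
  apply/eqP/negPn/negP => v0; apply: nconc; exists (span_point v0).
  have Uv i : bilin S (row i U) v = 0.
    rewrite /bilin -!row_mul mxE -[U *m S *m v^T]trmxK trmx_mul trmxK vUS.
    by rewrite !mxE.
  rewrite /on_line -!memvE l1E l2E l3E.
  move: (Uv ord0) (Uv (lift ord0 ord0)) (Uv (lift ord0 (lift ord0 ord0))).
  by rewrite !rowK /= => -> -> ->.
have [unitU unitS] : U \in unitmx /\ S \in unitmx.
  by apply/andP; rewrite -unitmx_mul.
have isoU i : bilin S (row i U) (row i U) = 0.
  by rewrite rowK; case: i => [[|[|[|//]]] ?].
have [C unitC CE] := isotropic_parametrization two0 symS unitU unitS isoU.
exists C => // P l /(tangent_bilin FE) [u [u0 uu lE]].
have [a [k [a0 k0 kE]]] := CE u u0 uu.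
by exists a; split=> // v; rewrite lE kE mulf_eq0 (negPf k0).
Qed.

Variables (C : 'M[K]_3) (unitC : C \in unitmx).

Lemma tangent_parameter_bracket l m a b :
  tangent_parameter C l a -> tangent_parameter C m b -> l != m ->
  bracket a b != 0.
Proof.
move=> [a0 lE] [b0 mE]; apply: contra_neq => ab0.
have [k k0 bE] := bracket_proportional a0 b0 ab0.
apply/val_inj/vspaceP => v; rewrite lE mE bE.
have -> : binary_form (v *m C) (k * a.1, k * a.2) =
    k ^+ 2 * binary_form (v *m C) a.
  by rewrite /binary_form !big_ord_recl !big_ord0 /=; ring.
by rewrite mulf_eq0 expf_eq0 (negPf k0).
Qed.

Lemma dim_line_cap l m : l != m -> \dim (line_space l :&: line_space m) == 1%N.
Proof.
case: l m => U dU [V dV]; rewrite -val_eqE /= => UV.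
have le3 : (\dim (U + V) <= 3)%N.
  by rewrite (leq_trans (dimvS (subvf _))) // dimvf /dim /=.
have := dimv_sum_cap U V; rewrite (eqP dU) (eqP dV) => e.
rewrite eqn_leq; apply/andP; split; last first.
  by rewrite -(leq_add2l (\dim (U + V))) e addn1 ltnS.
have le2 : (\dim (U :&: V) <= 2)%N.
  by have := dimvS (capvSl U V); rewrite (eqP dU).
rewrite -ltnS ltn_neqAle le2 andbT.
apply: contra UV => /eqP cap2; apply/eqP.
have capU : (U :&: V)%VS = U.
  by apply/eqP; rewrite eqEdim capvSl cap2 (eqP dU).
have capV : (U :&: V)%VS = V.
  by apply/eqP; rewrite eqEdim capvSr cap2 (eqP dV).
by rewrite -capU -[RHS]capV.
Qed.

(** The quadratic with roots [a] and [b] lies on both lines; [invmx C] brings it back to the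
    plane. *)
Lemma cap_tangents l m a b :
  tangent_parameter C l a -> tangent_parameter C m b -> l != m ->
  exists2 P, point_space P = (line_space l :&: line_space m)%VS &
    prod2 a b *m invmx C \in point_space P.
Proof.
move=> [_ lE] [_ mE] lm; exists (Point (dim_line_cap lm)) => //=.
rewrite memv_cap lE mE mulmxKV // !binary_form_prod2 /bracket.
by apply/andP; split; apply/eqP; ring.
Qed.

(** [N] is the matrix [M] transported to the coordinates in which points are binary quadratics. *)
Lemma star_bilin F (M : 'M[K]_3) l1 l2 l3 a1 a2 a3 :
  tangent_parameter C l1 a1 -> tangent_parameter C l2 a2 ->
  tangent_parameter C l3 a3 -> uniq [:: l1; l2; l3] ->
  (forall P u, zeros F P -> u \in point_space P -> bilin M u u = 0) ->
  star l1 l2 l3 `<=` zeros F ->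
  let N := invmx C *m M *m (invmx C)^T in
  [/\ bilin N (prod2 a1 a2) (prod2 a1 a2) = 0,
      bilin N (prod2 a1 a3) (prod2 a1 a3) = 0 &
      bilin N (prod2 a2 a3) (prod2 a2 a3) = 0].
Proof.
move=> t1 t2 t3; rewrite /= !inE !negb_or !andbT => /andP [/andP [l12 l13] l23].
move=> FM starF.
have NE u : bilin (invmx C *m M *m (invmx C)^T) u u =
    bilin M (u *m invmx C) (u *m invmx C).
  by rewrite /bilin trmx_mul !mulmxA.
rewrite !NE; split.
- have [P PE uP] := cap_tangents t1 t2 l12.
  by apply: FM uP; apply: starF; rewrite /star /=; apply: Or31.
- have [P PE uP] := cap_tangents t1 t3 l13.
  by apply: FM uP; apply: starF; rewrite /star /=; apply: Or32.
have [P PE uP] := cap_tangents t2 t3 l23.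
by apply: FM uP; apply: starF; rewrite /star /=; apply: Or33.
Qed.

(* [q] does not depend on the two stars, only on the functional [phi]. *)
Lemma union_stars_vanish F l1 l2 l3 m1 m2 m3 a1 a2 a3 b1 b2 b3
    (phi : 'cV[K]_4) q (v0 : q *m invmx C != 0) :
  tangent_parameter C l1 a1 -> tangent_parameter C l2 a2 ->
  tangent_parameter C l3 a3 -> tangent_parameter C m1 b1 ->
  tangent_parameter C m2 b2 -> tangent_parameter C m3 b3 ->
  uniq [:: l1; l2; l3; m1; m2; m3] ->
  conic F -> star l1 l2 l3 `|` star m1 m2 m3 `<=` zeros F ->
  phi != 0 -> prod3 a1 a2 a3 *m phi = 0 -> prod3 b1 b2 b3 *m phi = 0 ->
  mulX q *m phi = 0 -> mulY q *m phi = 0 ->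
  zeros F (span_point v0).
Proof.
move=> tl1 tl2 tl3 tm1 tm2 tm3 dist cF starF phi0 f0 g0 X0 Y0.
have [M [FM MF]] := zeros_bilin cF.
have /and3P [uniql disj uniqm] :
    [&& uniq [:: l1; l2; l3], ~~ has (mem [:: l1; l2; l3]) [:: m1; m2; m3]
      & uniq [:: m1; m2; m3]] by rewrite -cat_uniq.
have [Na Nb Nc] := star_bilin tl1 tl2 tl3 uniql FM
  (fun P h => starF P (or_introl h)).
have [_ Nb' Nc'] := star_bilin tm1 tm2 tm3 uniqm FM
  (fun P h => starF P (or_intror h)).
apply: MF.
have -> : bilin M (q *m invmx C) (q *m invmx C) =
    bilin (invmx C *m M *m (invmx C)^T) q q.
  by rewrite /bilin trmx_mul !mulmxA.
have ne l m : l \in [:: l1; l2; l3] -> m \in [:: m1; m2; m3] -> l != m.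
  move=> lin min; apply/negP => /eqP lm; move/negP: disj; apply.
  apply/hasP; exists m; first exact: min.
  rewrite -lm; exact: lin.
move: uniql uniqm; rewrite /= !inE !negb_or !andbT.
move=> /andP [/andP [l12 l13] l23] /andP [/andP [m12 _] _].
apply: (vanish_at_common_root _ _ _ _ _ Na Nb Nc Nb' Nc' phi0 f0 g0 X0 Y0).
- move=> x y; rewrite !inE => /or3P [] /eqP -> /or3P [] /eqP ->;
  (apply: tangent_parameter_bracket; [eassumption|eassumption|]);
  by apply: ne; rewrite !inE eqxx ?orbT.
- exact: tangent_parameter_bracket tl1 tl2 l12.
- exact: tangent_parameter_bracket tl1 tl3 l13.
- exact: tangent_parameter_bracket tl2 tl3 l23.
exact: tangent_parameter_bracket tm1 tm2 m12.
Qed.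

End TangentLines.

(** * The common point of the three conics *)

Theorem proposition5p3 (R : realType) (F : {mpoly R[i][3]})
    (l1 l2 l3 m1 m2 m3 n1 n2 n3 : line R[i])
    (F12 F13 F23 : {mpoly R[i][3]}) :
  irreducible_conic F ->
  contact_star F l1 l2 l3 ->
  contact_star F m1 m2 m3 ->
  contact_star F n1 n2 n3 ->
  uniq [:: l1; l2; l3; m1; m2; m3; n1; n2; n3] ->
  conic F12 -> star l1 l2 l3 `|` star m1 m2 m3 `<=` zeros F12 ->
  conic F13 -> star l1 l2 l3 `|` star n1 n2 n3 `<=` zeros F13 ->
  conic F23 -> star m1 m2 m3 `|` star n1 n2 n3 `<=` zeros F23 ->
  zeros F12 `&` zeros F13 `&` zeros F23 !=set0.
Proof.
move=> [cF _] starl starm starn dist c12 s12 c13 s13 c23 s23.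
have two0 : 2%:R != 0 :> R[i] by rewrite Num.Theory.pnatr_eq0.
(* The parametrization built from the first star gives parameters for all nine tangents, since [par]
   applies to every tangent of [F]. *)
have [C unitC par] := exists_parametrization two0 cF starl.
case: starl => _
  [P1 [P2 [P3 [_ []]]]] /par [a1 tl1] /par [a2 tl2] /par [a3 tl3].
case: starm => _
  [Q1 [Q2 [Q3 [_ []]]]] /par [b1 tm1] /par [b2 tm2] /par [b3 tm3].
case: starn => _
  [S1 [S2 [S3 [_ []]]]] /par [c1 tn1] /par [c2 tn2] /par [c3 tn3].
(* One [phi] annihilates the cubics of all three stars, so the same [q] serves each pair. *)
have [phi [q [[phi0 q0 fphi gphi hphi] [Xphi Yphi]]]] :=
  exists_common_root (prod3 a1 a2 a3) (prod3 b1 b2 b3) (prod3 c1 c2 c3).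
have v0 : q *m invmx C != 0.
  apply: contraNneq q0 => e.
  by rewrite -(mulmxKV unitC q) e mul0mx.
have sub_uniq s : subseq s [:: l1; l2; l3; m1; m2; m3; n1; n2; n3] -> uniq s.
  by move=> sub; exact: subseq_uniq sub dist.
have d12 : uniq [:: l1; l2; l3; m1; m2; m3].
  exact/sub_uniq/(prefix_subseq _ [:: n1; n2; n3]).
have d13 : uniq [:: l1; l2; l3; n1; n2; n3].
  apply/sub_uniq/(cat_subseq (subseq_refl [:: l1; l2; l3])).
  exact: (suffix_subseq [:: m1; m2; m3]).
have d23 : uniq [:: m1; m2; m3; n1; n2; n3].
  exact/sub_uniq/(suffix_subseq [:: l1; l2; l3]).
exists (span_point v0); split; first split.
- exact: (union_stars_vanish unitC tl1 tl2 tl3 tm1 tm2 tm3 d12 c12 s12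
    phi0 fphi gphi Xphi Yphi).
- exact: (union_stars_vanish unitC tl1 tl2 tl3 tn1 tn2 tn3 d13 c13 s13
    phi0 fphi hphi Xphi Yphi).
exact: (union_stars_vanish unitC tm1 tm2 tm3 tn1 tn2 tn3 d23 c23 s23
    phi0 gphi hphi Xphi Yphi).
Qed.
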